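(* Let $k$ be an integer with $1<k\le 5$, or $k=7$, or $k=9$. The $k$-simplex numbers are $\binom{m+k-1}{k}$ for positive integers $m$. For a positive integer $n$ put $s=\left\lfloor\sqrt[k]{k!\,n}\right\rfloor$ and $t=\left\lfloor\frac{k}{2}\right\rfloor$. Then the $n$-th smallest positive integer that is not a $k$-simplex number equals $$a(n)=\begin{cases} n+s-t+2 & \text{if } n+s-t+1\ge\binom{s+\lceil k/2\rceil+1}{k},\\ n+s-t & \text{if } n+s-t<\binom{s+\lceil k/2\rceil}{k},\\ n+s-t+1 & \text{otherwise.}\end{cases}$$ *)

(* Defs.v *)
From mathcomp Require Import all_boot all_order all_algebra all_field.

Set Implicit Arguments.
Unset Strict Implicit.
Unset Printing Implicit Defensive.

Import Order.TTheory GRing.Theory Num.Theory.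

Definition simplex_number (k x : nat) : Prop :=
  exists2 m, 0 < m & x = 'C(m + k - 1, k).

(* [x] is the [n]-th smallest natural number satisfying [P], for [n > 0]
   (counting from 1): the list [l] enumerates the numbers [<= x] that
   satisfy [P]. *)
Definition nth_smallest (P : nat -> Prop) (n x : nat) : Prop :=
  P x /\
  exists l : seq nat,
    [/\ uniq l, size l = n & forall y, y \in l <-> P y /\ y <= x].

(* For [k > 0], [k.-root] of a natural number is its nonnegative real [k]-th
   root, and [Num.truncn] is the floor on nonnegative reals. *)
Definition floor_root (k x : nat) : nat :=
  Num.truncn (k.-root (x%:R : algC))%R.

(* For the exponents considered, the truncated subtraction [n + s - t] with
   [s = floor_root k (k`! * n)] and [t = k./2] is an exact difference. *)
Lemma half_le_floor_root (k n : nat) :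
  [|| 1 < k <= 5, k == 7 | k == 9] -> 0 < n ->
  k./2 <= floor_root k (k`! * n).
Proof.
move=> hk n_gt0.
have k_gt0 : 0 < k by case: k hk.
have hpow : k./2 ^ k <= k`!.
  by case/or3P: hk => [|/eqP->|/eqP->];
    [move: k {k_gt0} => [|[|[|[|[|[|k]]]]]] | vm_compute | vm_compute].
have root_ge0 : (0 <= k.-root ((k`! * n)%:R : algC))%R.
  by rewrite rootC_ge0 // ler0n.
have /andP[_ hlt] := truncn_itv root_ge0.
have : ((k./2)%:R <= k.-root ((k`! * n)%:R : algC))%R.
  rewrite -(ler_pXn2r k_gt0) ?nnegrE ?ler0n // rootCK // -natrX ler_nat.
  by apply: (leq_trans hpow); rewrite leq_pmulr.
by move=> /le_lt_trans/(_ hlt); rewrite ltr_nat ltnS.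
Qed.

(* Main.v *)
(** The k-simplex numbers are [f i = 'C(i + k, k)], [i >= 0].  As in the
    Lambek-Moser theorem, the n-th number outside the range of an increasing [f]
    is [n + j], where [j] is the only index with [f (j-1) < n + j < f j].
    Write [s = x + t].  Pairing opposite factors of [x (x+1) ... (x+k-1)] bounds
    this product by [(x + t)^k <= k! n], so [j >= x]; and for the listed [k] the
    polynomial inequality
    [(x+t+1)^k + k! (x+2) <= (x+3) (x+4) ... (x+k+2)] yields [j <= x + 2].  The
    three cases of the formula are the three values left for [j]. *)

Require Import Defs.
From mathcomp Require Import all_boot all_order all_algebra all_field.
From mathcomp Require Import zify.

Import Order.TTheory GRing.Theory Num.Theory.

(** Trades the root taken in [algC] for two inequalities in [nat], the form in which [s] is used
    below. *)
Lemma floor_rootP (k x : nat) : 0 < k ->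
  floor_root k x ^ k <= x < (floor_root k x).+1 ^ k.
Proof.
move=> k_gt0.
have root_ge0 : (0 <= k.-root (x%:R : algC))%R by rewrite rootC_ge0 // ler0n.
have /andP[] := truncn_itv root_ge0.
rewrite -/(floor_root k x) -(ler_pXn2r k_gt0) ?nnegrE ?ler0n //.
rewrite -(ltr_pXn2r k_gt0) ?nnegrE ?ler0n // rootCK // -!natrX ler_nat ltr_nat.
by move=> -> ->.
Qed.

(** The values of [f] up to [n + j] are exactly those at the indices below [j], and all of them are
    positive; deleting these [j] values from [1..n + j] leaves [n] numbers. *)
Lemma nth_smallest_notin_range (f : nat -> nat) (j n : nat) :
  {homo f : a b / a < b} -> 0 < f 0 -> 0 < n ->
  (forall i, i < j -> f i < n + j) -> n + j < f j ->
  nth_smallest (fun y => 0 < y /\ ~ exists i, y = f i) n (n + j).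
Proof.
move=> f_homo f0_gt0 n_gt0 f_lt f_gt.
have f_mono : {mono f : a b / a <= b} := leq_mono f_homo.
pose r := [seq f i | i <- iota 0 j].
have rP y : y <= n + j -> reflect (exists i, y = f i) (y \in r).
  move=> le_y; apply: (iffP mapP) => [[i _ ->]|[i def_y]]; first by exists i.
  exists i => //; rewrite mem_iota add0n /= ltnNge -f_mono -ltnNge -def_y.
  exact: leq_ltn_trans f_gt.
have r_uniq : uniq r by rewrite map_inj_uniq ?iota_uniq //; apply: incn_inj.
split.
  split; first by rewrite addn_gt0 n_gt0.
  case/(rP _ (leqnn _))/mapP => i; rewrite mem_iota add0n => /f_lt /[swap] <-.
  by rewrite ltnn.
exists [seq y <- iota 1 (n + j) | y \notin r]; split.
- by rewrite filter_uniq ?iota_uniq.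
- have : count [in r] (iota 1 (n + j)) = j.
    rewrite -size_filter -[RHS](size_iota 0) -(size_map f) -/r.
    apply/perm_size/uniq_perm; rewrite ?filter_uniq ?iota_uniq // => y.
    rewrite mem_filter mem_iota add1n ltnS andb_idr // => /mapP[i].
    rewrite mem_iota add0n => /f_lt /ltnW fi_le ->; rewrite fi_le andbT.
    by apply: leq_trans f0_gt0 _; rewrite f_mono.
  have := count_predC [in r] (iota 1 (n + j)).
  by rewrite size_iota size_filter => /[swap] ->; rewrite addnC => /addIn.
- move=> y; rewrite mem_filter mem_iota add1n ltnS.
  split=> [/andP[/negP y_r /andP[y_gt0 le_y]]|[[y_gt0 y_f] le_y]].
    by split=> //; split=> // /(rP _ le_y).
  by rewrite y_gt0 le_y !andbT; apply/negP => /(rP _ le_y).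
Qed.

Lemma ltn_bin_addr (k a b : nat) : 0 < k -> a < b -> 'C(a + k, k) < 'C(b + k, k).
Proof.
case: k => // k _ lt_ab.
apply: (@leq_trans 'C(a.+1 + k.+1, k.+1)); last by rewrite leq_bin2l ?leq_add2r.
by rewrite addSn binS -[X in X < _]addn0 ltn_add2l bin_gt0 addnS ltnW // ltnS leq_addl.
Qed.

Lemma prod_addn_leq_exp (k t x : nat) : k <= t.*2.+1 ->
  \prod_(i < k) (x + i) <= (x + t) ^ k.
Proof.
move=> le_kt; rewrite -leq_sqr {1}expnS expn1 -expnM mulnC expnM.
rewrite [X in X * _](reindex_inj rev_ord_inj) -big_split /=.
rewrite -[X in _ ^ X](card_ord k) -prod_nat_const; apply: leq_prod => i _.
have i_lt := ltn_ord i.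
rewrite -(leq_pmul2l (isT : 0 < 4)); apply: leq_trans (nat_AGM2 _ _) _.
have le_2t : x + (k - i.+1) + (x + i) <= 2 * (x + t) by lia.
by rewrite -[4]/(2 ^ 2) -expnMn leq_sqr.
Qed.

Lemma ffact_add_prod (k x : nat) : (x + k) ^_ k = \prod_(i < k) (x + i.+1).
Proof.
elim: k => [|k IHk]; first by rewrite ffactn0 big_ord0.
by rewrite addnS ffactSS IHk big_ord_recr /= mulnC addnS.
Qed.

(** For each listed [k], both sides are polynomials in [x] and the inequality already holds
    coefficient by coefficient. *)
Lemma exp_add_leq_ffact (k x : nat) : [|| 1 < k <= 5, k == 7 | k == 9] ->
  (x + k./2 + 1) ^ k + k`! * (x + 2) <= (x + 2 + k) ^_ k.
Proof.
have k_cases : [|| 1 < k <= 5, k == 7 | k == 9] ->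
  k \in [:: 2; 3; 4; 5; 7; 9].
    by case/or3P=> [|/eqP->|/eqP->] //; move: k => [|[|[|[|[|[|k]]]]]].
move/k_cases; rewrite ffact_add_prod !inE.
by do ![case/predU1P=> [->|] | move/eqP->]; rewrite !big_ord_recr big_ord0 !factS fact0 /=
  ?expnS expn0; nia.
Qed.

Theorem theorem8 (k n : nat) (hk : [|| 1 < k <= 5, k == 7 | k == 9])
    (hn : 0 < n) :
  let s := floor_root k (k`! * n) in
  let t := k./2 in
  nth_smallest (fun x => 0 < x /\ ~ simplex_number k x) n
    (if 'C(s + uphalf k + 1, k) <= n + s - t + 1 then n + s - t + 2
     else if n + s - t < 'C(s + uphalf k, k) then n + s - t
     else n + s - t + 1).
Proof.
move=> s t; have k_gt0 : 0 < k by case: k hk {s t}.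
have /andP[s_le s_gt] := floor_rootP k (k`! * n) k_gt0.
(* Rests on [t ^ k <= k!], true for the listed [k] but false for 6 and 8. *)
have le_ts : t <= s := half_le_floor_root hk hn.
have [x def_s] : exists x, s = x + t by exists (s - t); rewrite subnK.
have half_k : t + uphalf k = k by rewrite uphalf_half addnCA addnn odd_double_half.
have bin_lo i : i < x -> 'C(i + k, k) < n + x.
  (* The binomial is even at most [n]; strictness comes from [x > 0]. *)
  move=> lt_ix; apply: (@leq_ltn_trans n); last by lia.
  rewrite -(leq_pmul2l (fact_gt0 k)); apply: leq_trans s_le.
  rewrite mulnC bin_ffact ffact_add_prod -/s def_s.
  apply: leq_trans (prod_addn_leq_exp k t x _); last by rewrite /t; lia.
  by apply: leq_prod => m _; lia.
have bin_hi : n + x + 2 < 'C(x + 2 + k, k).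
  rewrite -(ltn_pmul2l (fact_gt0 k)) [X in _ < X]mulnC bin_ffact.
  apply: leq_trans (exp_add_leq_ffact k x hk).
  by rewrite -addnA mulnDr ltn_add2r -/t -def_s addn1.
have simplexP y : simplex_number k y <-> exists i, y = 'C(i + k, k).
  split=> [[[//|m] _ ->]|[i ->]]; first by exists m; rewrite addSnnS addnS subn1.
  by exists i.+1; rewrite // addSn subn1.
have main j : (forall i, i < j -> 'C(i + k, k) < n + j) -> n + j < 'C(j + k, k) ->
    nth_smallest (fun y => 0 < y /\ ~ simplex_number k y) n (n + j).
  move=> j_lo j_hi.
  have bin0_gt0 : 0 < 'C(0 + k, k) by rewrite binn.
  have [[P1 P2] [l [l_uniq l_size lP]]] :=
    nth_smallest_notin_range (fun i => 'C(i + k, k)) j n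
      (fun a b => ltn_bin_addr k a b k_gt0)
      bin0_gt0 hn j_lo j_hi.
  split; first by split=> // /simplexP.
  exists l; split=> // y; rewrite lP.
  by split=> -[[? H] ?]; do !split=> //; move=> /simplexP.
have bin_mono i j : i <= j -> 'C(i + k, k) <= 'C(j + k, k).
  by move=> le_ij; rewrite leq_bin2l ?leq_add2r.
have -> : n + s - t = n + x by lia.
(* Since [t + uphalf k = k], the binomials tested in the formula are those of index [x + 1] and
   [x]. *)
have -> : s + uphalf k = x + k by lia.
(* The branches take [j = x + 2], [j = x] and [j = x + 1]. The first gets its upper bound from
   [bin_hi], the second its lower bounds from [bin_lo], and the third both from the failed tests. *)
rewrite (addnAC x); case: (leqP 'C(x + 1 + k, k)) => [bin_le|bin_gt].
  rewrite -addnA; apply: main; last by rewrite addnA.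
  move=> i lt_i; have : 'C(i + k, k) <= 'C(x + 1 + k, k) by apply: bin_mono; lia.
  by lia.
case: ltnP => [|bin_le]; first exact: main bin_lo.
rewrite -addnA; apply: main; last by rewrite addnA.
move=> i lt_i; have : 'C(i + k, k) <= 'C(x + k, k) by apply: bin_mono; lia.
by lia.
Qed.
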